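(* A general homogeneous polynomial of degree $d$ in $n$ variables, with complex coefficients, of border rank $r$ is singular if $r<n$ and non-singular if $r\geq n$.
   Context: The rank of a homogeneous polynomial $f$ of degree $d$ in $n$ variables with complex coefficients is the smallest $r$ such that $f=l_1^d+\cdots+l_r^d$ with $l_i$ complex linear forms. The border rank of $f$ is the smallest $r$ such that $f$ can be written as a limit of polynomials of rank $r$. The Veronese variety is the set of $d$th powers of linear forms $l^d$, considered up to scale, and its $r$th secant variety is the Zariski closure of the set of linear combinations of $r$ points on it, considered up to scale. A general polynomial of border rank $r$ is a general point of the $r$th secant variety of the Veronese variety. A point $p\in\mathbb{P}^{n-1}$ is a singular point of $f$ if all partial derivatives of $f$ vanish at $p$; $f$ is singular if it has a singular point, and non-singular otherwise.
   Formalization: The degree d is assumed to be at least 1, and at least 2 for the claim that the polynomial is singular when r<n; without this the claim fails (a nonzero linear form is never singular, and a nonzero constant has all partial derivatives zero). *)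

(* Defs.v *)
From HB Require Import structures.
From mathcomp Require Import all_boot all_order all_algebra.
From mathcomp Require Import classical_sets reals complex mpoly.

Set Implicit Arguments.
Unset Strict Implicit.
Unset Printing Implicit Defensive.

Import GRing.Theory.
Local Open Scope ring_scope.
Local Open Scope classical_set_scope.

(* Points of a projective space are handled through their nonzero
   representatives: a subset of P(S_d), where S_d is the space of forms of
   degree d in n variables, is encoded by the set of all nonzero forms
   representing one of its points. *)

Definition forms (C : closedFieldType) (n d : nat) : set {mpoly C[n]} :=
  [set f | f \is d.-homog /\ f != 0].

(* The exponents of degree d; the bound d.+1 only serves to make the type
   finite. *)
Definition exponent (n d : nat) : finType :=
  {m : 'X_{1..n < d.+1} | mdeg m == d}.

(* The coefficients of f, i.e. its homogeneous coordinates in P(S_d). *)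
Definition coords (C : closedFieldType) (n d : nat) (f : {mpoly C[n]}) :
    'I_#|exponent n d| -> C :=
  fun i => f@_(val (val (enum_val i))).

Definition zariski_closed (C : closedFieldType) (n d : nat)
    (Z : set {mpoly C[n]}) : Prop :=
  exists2 E : set {mpoly C[#|exponent n d|]},
    forall F, E F -> exists e : nat, F \is e.-homog
  & Z = [set f | forms d f /\ forall F, E F -> F.@[coords (d := d) f] = 0].

Definition zariski_closure (C : closedFieldType) (n d : nat)
    (A : set {mpoly C[n]}) : set {mpoly C[n]} :=
  smallest (zariski_closed (n := n) d) A.

Definition veronese (C : closedFieldType) (n d : nat) : set {mpoly C[n]} :=
  [set g | exists a : C, exists l : {mpoly C[n]},
     [/\ a != 0, forms 1 l & g = a *: l ^+ d]].

Definition secant_points (C : closedFieldType) (n d r : nat) :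
    set {mpoly C[n]} :=
  [set f | f != 0 /\
     exists (g : 'I_r -> {mpoly C[n]}) (c : 'I_r -> C),
       (forall i, veronese d (g i)) /\ f = \sum_(i < r) c i *: g i].

Definition secant_variety (C : closedFieldType) (n d r : nat) :
    set {mpoly C[n]} :=
  zariski_closure d (secant_points (C := C) (n := n) d r).

(* P holds at a general point of X: it holds on X minus a Zariski closed Z,
   where X minus Z is dense in X. *)
Definition general_point (C : closedFieldType) (n d : nat)
    (X P : set {mpoly C[n]}) : Prop :=
  exists Z : set {mpoly C[n]},
    [/\ zariski_closed d Z,
        X `<=` zariski_closure d (X `\` Z)
      & X `\` Z `<=` P].

(* A general form of border rank r is by definition a general point of the
   r-th secant variety. *)
Definition general_of_border_rank (C : closedFieldType) (n d r : nat)
    (P : set {mpoly C[n]}) : Prop :=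
  general_point d (secant_variety (C := C) (n := n) d r) P.

Definition singular_point (C : closedFieldType) (n : nat) (f : {mpoly C[n]})
    (p : 'I_n -> C) : Prop :=
  (exists i, p i != 0) /\ forall i, (f^`M(i)).@[p] = 0.

Definition singular (C : closedFieldType) (n : nat) (f : {mpoly C[n]}) : Prop :=
  exists p : 'I_n -> C, singular_point f p.

(* Main.v *)
Require Import Defs.
From HB Require Import structures.
From mathcomp Require Import all_boot all_order all_algebra.
From mathcomp Require Import classical_sets reals complex mpoly.

(** Polynomial conditions on a form enter only through determinants: if the
    entries of a square matrix are linear functionals of the form [f], its
    determinant is a homogeneous polynomial in the coefficients of [f]
    ([det_as_form]).

    Few powers ([r < n]).  The [r] linear forms have a common zero [v <> 0],
    and the derivative in the direction [v] kills their powers, so the partial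
    derivatives of [f] satisfy a linear relation with coefficients [v].
    Having linearly dependent partial derivatives is a Zariski closed
    condition, given by the maximal minors of the matrix of the coefficients of
    these derivatives ([dependent_partials_closed]); hence the
    relation persists on the whole secant variety.  When [1 < d], Euler's
    identity for each partial derivative turns the relation into the vanishing
    of that derivative at [v] ([singular_of_dependent_partials]).  So every
    point of the secant variety is singular, and nothing has to be removed.

    Many powers ([n <= r]).  The Fermat form [x_1^d + ... + x_n^d] is a
    sum of [r] powers, up to zero terms.  It is non-singular, and the
    hypersurface to remove must witness this by one polynomial in the
    coefficients of [f].  Macaulay's determinant does so
    ([macaulay_form]): in degree [D = n * d] every monomial is divisible by
    some [x_i^(d-1)], and replacing that factor by the [i]-th partial
    derivative of [f] gives a square matrix of coefficients.  It is [d] times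
    the identity at the Fermat form, and where it is invertible all monomials
    of degree [D] belong to the ideal of the partial derivatives, so that these
    have no common zero except the origin.  Finally, the complement of a
    hypersurface that misses one sum of [r] powers is dense in the secant
    variety: any sum of [r] powers is joined to the given one by a curve of
    such sums, and a polynomial in one parameter that vanishes at all but
    finitely many points is zero ([general_of_nonvanishing]). *)

Set Implicit Arguments.
Unset Strict Implicit.
Unset Printing Implicit Defensive.

Import GRing.Theory Num.Theory.

Local Open Scope ring_scope.
Local Open Scope classical_set_scope.

(** * Derivatives, products and determinants of homogeneous polynomials *)

Section Homogeneous.
Variables (n : nat) (R : comNzRingType).
Implicit Types f g l : {mpoly R[n]}.

Lemma dhomog_mderiv d i f : f \is d.-homog -> f^`M(i) \is d.-1.-homog.
Proof.
move=> hf; apply/dhomogP => m; rewrite mcoeff_msupp mcoeff_deriv => nz.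
have nz' : f@_(m + U_(i)) != 0 by apply: contraNneq nz => ->; rewrite mul0rn.
have := dhomog_mf hf; rewrite /prop_in1 => /(_ (m + U_(i))%MM).
by rewrite mcoeff_msupp => /(_ nz') <-; rewrite /= mdegD mdeg1 addn1.
Qed.

Lemma euler_mderiv d f : f \is d.-homog ->
  \sum_i 'X_i * f^`M(i) = d%:R *: f.
Proof.
move=> hf; rewrite {2}(mpolyE f) scaler_sumr.
transitivity
    (\sum_i \sum_(m <- msupp f) ((m i)%:R * f@_m) *: 'X_[m] : {mpoly R[n]}).
  apply: eq_bigr => i _; rewrite {1}(mpolyE f) raddf_sum mulr_sumr.
  apply: eq_bigr => m _ /=; rewrite mderivZ mderivX -!scalerAr scalerA mulrC.
  (* The truncated exponent [m - U_(i)] is harmless: its coefficient vanishes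
     exactly when the subtraction is not exact. *)
  case: (posnP (m i)) => [->|m_i].
    by rewrite mulr0n !(mul0r, mulr0, scale0r).
  rewrite -mpolyXD mulrC; congr (_ *: 'X_[_]).
  rewrite addmC submK //; apply/mnm_lepP => j.
  by rewrite mnm1E; case: eqP => [<-|].
rewrite exchange_big /= big_seq [RHS]big_seq; apply: eq_bigr => m mf.
rewrite -scaler_suml -mulr_suml scalerA -natr_sum -mdegE.
by have /= -> := dhomog_mf hf mf.
Qed.

Lemma linear_mderiv l i : l \is 1.-homog -> l^`M(i) = (l@_U_(i))%:MP.
Proof.
move=> hl; apply/mpolyP => m; rewrite mcoeff_deriv mcoeffC.
have [->|m0] := eqVneq m 0%MM; first by rewrite add0m mnm0E mulr1.
rewrite (dhomog_nemf_coeff hl) ?mul0rn ?mulr0 //=.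
by rewrite mdegD mdeg1 addn1 eqSS mdeg_eq0.
Qed.

Lemma power_mderiv l k i : (l ^+ k)^`M(i) = (l ^+ k.-1 * l^`M(i)) *+ k.
Proof.
case: k => [|k /=]; first by rewrite expr0 mulr0n -mpolyC1 mderivC.
elim: k => [|k IH]; first by rewrite expr1 expr0 mul1r.
rewrite exprS mderivM IH mulrC -mulrnAr mulrA -exprS [in RHS]mulrSr.
by rewrite mulrnAr addrC.
Qed.

Lemma dhomog_prod_ord N (F : 'I_N -> {mpoly R[n]}) e :
  (forall i, F i \is e.-homog) -> \prod_i F i \is (e * N).-homog.
Proof.
elim: N F => [|N IH] F hF; first by rewrite big_ord0 muln0 dhomog1.
rewrite big_ord_recr mulnS addnC; apply: dhomogM => //.
by apply: IH => i; apply: hF.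
Qed.

Lemma dhomog_det N (A : 'M[{mpoly R[n]}]_N) e :
  (forall i j, A i j \is e.-homog) -> \det A \is (e * N).-homog.
Proof.
move=> hA; apply: rpred_sum => s _.
by rewrite mulr_sign; case: ifP => _; rewrite ?rpredN; apply: dhomog_prod_ord.
Qed.

End Homogeneous.

(** * Linear functionals and determinants in the coordinates of a form *)

Section Coordinates.
Variables (C : closedFieldType) (n d : nat).
Implicit Types f g : {mpoly C[n]}.

Definition nth_exponent (i : 'I_#|exponent n d|) : 'X_{1..n} :=
  val (val (enum_val i)).

Lemma mdeg_nth_exponent i : mdeg (nth_exponent i) = d.
Proof. exact/eqP/(valP (enum_val i)). Qed.

Lemma nth_exponent_inj : injective nth_exponent.
Proof. by move=> i j /val_inj/val_inj/enum_val_inj. Qed.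

Lemma nth_exponent_onto m : mdeg m = d -> exists i, nth_exponent i = m.
Proof.
move=> hm; have lt_m : (mdeg m < d.+1)%N by rewrite hm.
have /eqP hm' := hm.
exists (enum_rank (exist (fun m : 'X_{1..n < d.+1} => mdeg m == d)
  (BMultinom lt_m) hm')).
by rewrite /nth_exponent enum_rankK.
Qed.

Lemma homog_expansion f : f \is d.-homog ->
  f = \sum_i coords (d := d) f i *: 'X_[nth_exponent i].
Proof.
move=> hf; apply/mpolyP => m; rewrite linear_sum /=.
have [hm|hm] := eqVneq (mdeg m) d; last first.
  rewrite (dhomog_nemf_coeff hf) // big1 // => i _.
  rewrite mcoeffZ mcoeffX; case: eqP => [e|_]; last by rewrite mulr0.
  by rewrite -e mdeg_nth_exponent eqxx in hm.
have [i <-] := nth_exponent_onto hm.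
rewrite (bigD1 i) //= mcoeffZ mcoeffX eqxx mulr1 big1 ?addr0 // => j ji.
by rewrite mcoeffZ mcoeffX (inj_eq nth_exponent_inj) (negbTE ji) mulr0.
Qed.

(** The polynomial in the coordinates whose values are those of the linear
    functional [L], once restricted to the forms of degree [d]. *)
Definition linear_form (L : {mpoly C[n]} -> C) : {mpoly C[#|exponent n d|]} :=
  \sum_i L 'X_[nth_exponent i] *: 'X_i.

Lemma meval_linear_form (L : {scalar {mpoly C[n]}}) f : f \is d.-homog ->
  (linear_form L).@[coords (d := d) f] = L f.
Proof.
move=> hf; rewrite {2}(homog_expansion hf) linear_sum raddf_sum.
by apply: eq_bigr => i _; rewrite /= mevalZ mevalXU linearZ /= mulrC.
Qed.

(** The source of all equations below: a condition expressed by such a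
    determinant is a hypersurface in the space of forms of degree [d]. *)
Lemma det_as_form N (L : 'I_N -> 'I_N -> {scalar {mpoly C[n]}}) :
  exists2 F : {mpoly C[#|exponent n d|]}, F \is N.-homog &
    forall f, f \is d.-homog ->
      F.@[coords (d := d) f] = \det (\matrix_(i, j) L i j f).
Proof.
exists (\det (\matrix_(i, j) linear_form (L i j))).
  rewrite -[N in N.-homog]mul1n; apply: dhomog_det => i j; rewrite mxE.
  by apply: rpred_sum => k _; rewrite rpredZ // dhomogX /= mdeg1.
move=> f hf; rewrite -det_map_mx; congr (\det _).
by apply/matrixP => i j; rewrite !mxE; apply: meval_linear_form.
Qed.

Lemma forms_closed : zariski_closed d (forms (C := C) (n := n) d).
Proof.
exists set0; first by [].
by apply/seteqP; split => f //= [].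
Qed.

Lemma set0_closed : zariski_closed d (set0 : set {mpoly C[n]}).
Proof.
exists [set 1]; first by move=> F ->; exists 0%N; apply: dhomog1.
apply/seteqP; split => f //= [_ /(_ 1 erefl)].
by rewrite meval1 => /eqP; rewrite oner_eq0.
Qed.

(** For [q = 1] these functionals are the coefficients of the partial derivatives,
    and for [q] a monomial the entries of Macaulay's matrix. *)
Definition partial_coef (q : {mpoly C[n]}) (i : 'I_n) (k : 'X_{1..n}) f : C :=
  (q * f^`M(i))@_k.

Lemma partial_coef_linear q i k : scalar (partial_coef q i k).
Proof.
move=> a f g; rewrite /partial_coef mderivD mderivZ mulrDr -scalerAr.
by rewrite mcoeffD mcoeffZ.
Qed.

HB.instance Definition _ q i k :=
  GRing.isLinear.Build C {mpoly C[n]} C *%R (partial_coef q i k)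
    (partial_coef_linear q i k).

End Coordinates.

(** * Sums of powers of linear forms *)

Section PowerSums.
Variables (C : closedFieldType) (n d r : nat).
Implicit Types (c : 'I_r -> C) (l : 'I_r -> {mpoly C[n]}).

Definition power_sum c l : {mpoly C[n]} := \sum_i c i *: l i ^+ d.

Lemma power_sum_homog c l :
  (forall i, l i \is 1.-homog) -> power_sum c l \is d.-homog.
Proof.
move=> hl; apply: rpred_sum => i _; apply: rpredZ.
by have := dhomogMn d (hl i); rewrite mul1n.
Qed.

Lemma secant_points_power_sum f : secant_points d r f -> f != 0 /\
  exists (l : 'I_r -> {mpoly C[n]}) (c : 'I_r -> C),
    (forall i, l i \is 1.-homog) /\ f = power_sum c l.
Proof.
move=> [f0 [g [c [gV def_f]]]].
have /fin_all_exists [a] : forall i, exists a m,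
    [/\ a != 0, forms 1 m & g i = a *: m ^+ d] by move=> i; apply: gV.
move=> /fin_all_exists [l gE].
split; [by [] | exists l; exists (fun i => c i * a i); split => [i|]].
  by have [_ []] := gE i.
by rewrite def_f; apply: eq_bigr => i _; have [_ _ ->] := gE i; rewrite scalerA.
Qed.

(** Some [l i] may vanish here, whereas points of the Veronese variety come from
    nonzero linear forms: such terms are replaced by a power of a variable with
    coefficient zero. *)
Lemma power_sum_secant_points c l : (0 < n)%N -> (0 < d)%N ->
  (forall i, l i \is 1.-homog) -> power_sum c l != 0 ->
  secant_points d r (power_sum c l).
Proof.
move=> n0 d0 hl f0; split => //.
pose x : {mpoly C[n]} := 'X_(Ordinal n0).
exists (fun i => if l i == 0 then x ^+ d else l i ^+ d).
exists (fun i => if l i == 0 then 0 else c i); split => [i|].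
  exists 1; have [_|li0] := eqVneq (l i) 0; [exists x | exists (l i)].
    split; [exact: oner_neq0 | split | by rewrite scale1r].
      by rewrite dhomogX /= mdeg1.
    by rewrite /x -msupp_eq0 msuppX.
  by split; [exact: oner_neq0 | split | rewrite scale1r].
apply: eq_bigr => i _; case: eqP => // ->.
by rewrite expr0n eqn0Ngt d0 scaler0 scale0r.
Qed.

Lemma secant_variety_sub_forms :
  secant_variety (C := C) (n := n) d r `<=` forms d.
Proof.
apply: smallest_sub; first exact: forms_closed.
move=> f /secant_points_power_sum [f0 [l [c [hl def_f]]]]; split => //.
by rewrite def_f; apply: power_sum_homog.
Qed.

End PowerSums.

(** * Forms with linearly dependent partial derivatives *)

Lemma left_kernel_of_minors (F : fieldType) (m k : nat) (B : 'M[F]_(m, k)) :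
  (forall s : 'I_m -> 'I_k, \det (colsub s B) = 0) ->
  exists2 v : 'rV_m, v != 0 & v *m B = 0.
Proof.
move=> minors.
have [full|nfull] := boolP (row_full B^T).
  have := fullrowsub_unit full.
  rewrite unitmxE -det_tr.
  have -> : (rowsub (fullrankfun full) B^T)^T = colsub (fullrankfun full) B.
    by apply/matrixP => i j; rewrite !mxE.
  by rewrite minors unitr0.
have : kermx B != 0 by rewrite kermx_eq0 /row_free -mxrank_tr.
by move=> /rowV0Pn [v /sub_kermxP vB v0]; exists v.
Qed.

Section DependentPartials.
Variables (C : closedFieldType) (n d : nat).
Implicit Types f : {mpoly C[n]}.

Definition dependent_partials : set {mpoly C[n]} :=
  [set f | forms d f /\
    exists2 v : 'rV[C]_n, v != 0 & \sum_i v 0 i *: f^`M(i) = 0].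

(** The equations are the determinants formed by [n] columns, with arbitrary
    repetitions, of the matrix whose row [i] lists the coefficients of the [i]-th
    partial derivative: they vanish together exactly when its rows are
    dependent. *)
Lemma dependent_partials_closed : zariski_closed d dependent_partials.
Proof.
pose minor (s : 'I_n -> 'X_{1..n}) (i j : 'I_n) : {scalar {mpoly C[n]}} :=
  partial_coef 1 i (s j).
exists [set F | F \is n.-homog /\ exists s : 'I_n -> 'X_{1..n},
  forall f, f \is d.-homog ->
    F.@[coords (d := d) f] = \det (\matrix_(i, j) minor s i j f)].
  by move=> F [hF _]; exists n.
apply/seteqP; split => f /= [[hf f0]].
  move=> [v v0 dep]; split => // F [_ [s ->]] //.
  apply/eqP/det0P; exists v => //; apply/rowP => j; rewrite !mxE.
  transitivity ((\sum_i v 0 i *: f^`M(i))@_(s j)); last by rewrite dep mcoeff0.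
  rewrite raddf_sum; apply: eq_bigr => i _.
  by rewrite mxE /= /partial_coef mul1r mcoeffZ.
move=> minors; split => //.
(* The partial derivatives have degree [d.-1], so finitely many columns carry
   all their coefficients. *)
pose B := \matrix_(i < n, k < #|{: 'X_{1..n < d}}|) (f^`M(i))@_(enum_val k).
have [s|v v0 vB] := @left_kernel_of_minors _ _ _ B.
  have [F hF detF] := det_as_form d (minor (fun j => enum_val (s j))).
  have <- : F.@[coords (d := d) f] = 0.
    by apply: minors; split => //; exists (fun j => bmnm (enum_val (s j))).
  rewrite detF //.
  by congr (\det _); apply/matrixP => i j; rewrite !mxE /= /partial_coef mul1r.
exists v => //; apply/mpolyP => m; rewrite mcoeff0 raddf_sum /=.
have [lt_m|ge_m] := ltnP (mdeg m) d.
  move/rowP/(_ (enum_rank (BMultinom lt_m))): vB.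
  rewrite !mxE => vB; rewrite -[RHS]vB; apply: eq_bigr => i _.
  by rewrite mxE enum_rankK mcoeffZ.
apply: big1 => i _; rewrite mcoeffZ mcoeff_deriv (dhomog_nemf_coeff hf).
  by rewrite mul0rn mulr0.
by rewrite /= mdegD mdeg1 addn1 gtn_eqF // ltnS.
Qed.

(** The coefficients [v] of the relation are a common zero of the linear forms,
    found in the kernel of the matrix of their coefficients. *)
Lemma few_powers_dependent_partials r : (r < n)%N ->
  secant_points d r `<=` dependent_partials.
Proof.
move=> rn f /secant_points_power_sum [f0 [l [c [hl def_f]]]].
have hf : f \is d.-homog by rewrite def_f; apply: power_sum_homog.
split => //.
pose A := \matrix_(j < n, i < r) (l i)@_U_(j).
have : kermx A != 0.
  rewrite kermx_eq0 /row_free neq_ltn (leq_ltn_trans _ rn) //.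
  exact: rank_leq_col.
move=> /rowV0Pn [v /sub_kermxP vA v0]; exists v => //.
rewrite def_f.
transitivity (\sum_(i < r) \sum_j v 0 j *: (c i *: l i ^+ d)^`M(j)).
  rewrite exchange_big; apply: eq_bigr => j _.
  by rewrite (raddf_sum (mderiv j)) scaler_sumr.
apply: big1 => i _.
transitivity ((c i *+ d) *: l i ^+ d.-1 * (\sum_j v 0 j * (l i)@_U_(j))%:MP).
  rewrite raddf_sum mulr_sumr; apply: eq_bigr => j _.
  rewrite mderivZ power_mderiv linear_mderiv // (mulrC _ _%:MP) mul_mpolyC.
  rewrite [RHS]mulrC mul_mpolyC -scaler_nat !scalerA; congr (_ *: _).
  by rewrite -(mulr_natr (c i)) -!mulrA; congr (_ * _); rewrite mulrA mulrC.
move/rowP/(_ i): vA; rewrite !mxE.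
under eq_bigr do rewrite mxE.
by move=> ->; rewrite mpolyC0 mulr0.
Qed.

End DependentPartials.

(** Euler's identity for the [j]-th partial derivative, evaluated at [v], has on
    its left the [j]-th derivative of the given relation. *)
Lemma singular_of_dependent_partials (C : numClosedFieldType) (n d : nat)
    (f : {mpoly C[n]}) (v : 'rV[C]_n) : (1 < d)%N ->
  f \is d.-homog -> v != 0 -> \sum_i v 0 i *: f^`M(i) = 0 ->
  singular_point f (v 0).
Proof.
move=> d1 hf v0 dep; split.
  by have /rV0Pn := v0.
move=> j.
have /(congr1 (meval (v 0))) := euler_mderiv (dhomog_mderiv j hf).
have -> : (\sum_i 'X_i * (f^`M(j))^`M(i)).@[v 0]
       = ((\sum_i v 0 i *: f^`M(i))^`M(j)).@[v 0].
  rewrite [in RHS](raddf_sum (mderiv j)) !rmorph_sum; apply: eq_bigr => i _ /=.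
  by rewrite mderivZ mevalZ mevalM mevalXU mderiv_comm.
rewrite dep mderiv0 meval0 mevalZ => /esym/eqP; rewrite mulf_eq0 pnatr_eq0.
by rewrite -(subnKC d1) => /eqP.
Qed.

(** * Density of the complement of a hypersurface in the secant variety *)

(** In characteristic zero the natural numbers provide more roots than a nonzero
    polynomial can have. *)
Lemma poly_eq0_horner (C : numDomainType) (p : {poly C}) :
  (forall t, p.[t] = 0) -> p = 0.
Proof.
move=> p0; apply/eqP/negP => /negP nz.
have := @max_poly_roots _ p [seq i%:R | i <- iota 0 (size p)] nz.
rewrite size_map size_iota ltnn => absurd; apply: notF; apply: absurd.
  by apply/allP => x _; rewrite /root p0.
by rewrite map_inj_uniq ?iota_uniq // => i j /eqP; rewrite eqr_nat => /eqP.
Qed.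

Section Density.
Variables (C : numClosedFieldType) (n d r : nat).
Hypotheses (n0 : (0 < n)%N) (d0 : (0 < d)%N).

(** A polynomial curve of forms is a form [Gam] whose coefficients are
    polynomials in the parameter. *)
Definition curve_point (Gam : {mpoly {poly C}[n]}) (t : C) : {mpoly C[n]} :=
  map_mpoly (horner_eval t) Gam.

Lemma form_along_curve (Gam : {mpoly {poly C}[n]})
    (F : {mpoly C[#|exponent n d|]}) :
  exists p : {poly C}, forall t,
    F.@[coords (d := d) (curve_point Gam t)] = p.[t].
Proof.
exists (mmap polyC (fun i => Gam@_(nth_exponent i)) F) => t.
rewrite mevalE /mmap horner_sum; apply: eq_bigr => m _.
rewrite hornerM hornerC /mmap1 horner_prod; congr (_ * _).
apply: eq_bigr => i _; rewrite horner_exp; congr (_ ^+ _).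
by rewrite /coords /curve_point mcoeff_map_mpoly.
Qed.

(** The given sum of powers and an arbitrary one are the values at [1] and [0] of
    the curve obtained by interpolating linearly all coefficients and all linear
    forms.  Along it, the product of [F] with any equation of [W] vanishes
    identically, and [F] does not. *)
Lemma secant_points_sub_of_avoiding (F : {mpoly C[#|exponent n d|]})
    (c1 : 'I_r -> C) (l1 : 'I_r -> {mpoly C[n]}) (W : set {mpoly C[n]}) :
  (forall i, l1 i \is 1.-homog) ->
  F.@[coords (d := d) (power_sum d c1 l1)] != 0 ->
  zariski_closed d W ->
  (forall f, secant_points d r f -> F.@[coords (d := d) f] != 0 -> W f) ->
  F.@[coords (d := d) (0 : {mpoly C[n]})] = 0 ->
  secant_points d r `<=` W.
Proof.
move=> hl1 F1 [E hE WE] avoid F0 f fS.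
have [f0 [l [c [hl def_f]]]] := secant_points_power_sum fS.
have hf : f \is d.-homog by rewrite def_f; apply: power_sum_homog.
rewrite WE; split => // G EG.
pose lin (a b : C) : {poly C} := (1 - 'X) * a%:P + 'X * b%:P.
pose lift (g : {mpoly C[n]}) := map_mpoly polyC g.
pose Gc i := lin (c i) (c1 i).
pose Gl i := (1 - 'X) *: lift (l i) + 'X *: lift (l1 i).
pose Gam := \sum_i Gc i *: Gl i ^+ d.
pose ct t i := (1 - t) * c i + t * c1 i.
pose lt t i := (1 - t) *: l i + t *: l1 i.
have GamE t : curve_point Gam t = power_sum d (ct t) (lt t).
  rewrite /curve_point rmorph_sum; apply: eq_bigr => i _.
  rewrite /= map_mpolyZ rmorphXn; congr (_ *: _ ^+ _).
    by rewrite /Gc /lin /= ?horner_evalE !hornerE.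
  rewrite rmorphD /= !map_mpolyZ /= ?horner_evalE !hornerE.
  by congr (_ *: _ + _ *: _); apply/mpolyP => m;
     rewrite !mcoeff_map_mpoly /= ?horner_evalE hornerC.
have [p pE] := form_along_curve Gam G.
have [q qE] := form_along_curve Gam F.
have pq0 : p * q = 0.
  apply: poly_eq0_horner => t; rewrite hornerM.
  have [->|qt] := eqVneq q.[t] 0; first by rewrite mulr0.
  suff : W (curve_point Gam t) by rewrite WE -pE => -[_ ->]; rewrite ?mul0r.
  apply: avoid; last by rewrite qE.
  rewrite GamE; apply: power_sum_secant_points => // [i|].
    by apply: rpredD; apply: rpredZ; [exact: hl | exact: hl1].
  (* The curve may pass through the zero form, but only where [q] vanishes. *)
  by apply: contraNneq qt => e0; rewrite -qE GamE e0 F0.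
have q0 : q != 0.
  apply: contraNneq F1 => q0.
  have -> : power_sum d c1 l1 = curve_point Gam 1.
    rewrite GamE; apply: eq_bigr => i _.
    by rewrite /ct /lt subrr mul0r add0r mul1r scale0r add0r scale1r.
  by rewrite qE q0 horner0.
have -> : f = curve_point Gam 0.
  rewrite GamE def_f; apply: eq_bigr => i _.
  by rewrite /ct /lt subr0 mul0r addr0 mul1r scale0r addr0 scale1r.
rewrite pE; move/eqP: pq0; rewrite mulf_eq0 (negbTE q0) orbF => /eqP ->.
exact: horner0.
Qed.

(** The only consequence of the irreducibility of the secant variety that is
    used: a hypersurface that misses one sum of powers has a dense complement. *)
Lemma general_of_nonvanishing e (F : {mpoly C[#|exponent n d|]})
    (c1 : 'I_r -> C) (l1 : 'I_r -> {mpoly C[n]}) (P : set {mpoly C[n]}) :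
  F \is e.-homog -> F.@[coords (d := d) (0 : {mpoly C[n]})] = 0 ->
  (forall i, l1 i \is 1.-homog) ->
  F.@[coords (d := d) (power_sum d c1 l1)] != 0 ->
  (forall f, f \is d.-homog -> F.@[coords (d := d) f] != 0 -> P f) ->
  general_of_border_rank d r P.
Proof.
move=> hF F0 hl1 F1 FP.
pose Z := [set f : {mpoly C[n]} | forms d f /\ F.@[coords (d := d) f] = 0].
have nZ f : (secant_variety d r `\` Z) f -> f \is d.-homog /\
    F.@[coords (d := d) f] != 0.
  move=> [/secant_variety_sub_forms ff nZf]; split; first by case: ff.
  by apply/eqP => Ff; apply: nZf.
exists Z; split.
- exists [set F]; first by move=> _ ->; exists e.
  by apply/seteqP; split => f /= [ff Ff]; split => //; [move=> G -> | exact: Ff].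
- move=> f Xf W [Wc XW]; apply: (smallest_sub Wc _ Xf).
  apply: (secant_points_sub_of_avoiding hl1 F1 Wc) => // g gS Fg; apply: XW.
  by split; [exact: sub_gen_smallest | move=> [_ /eqP]; apply/negP].
- by move=> f /nZ [hf Ff]; apply: FP.
Qed.

End Density.

(** * Macaulay's determinant and the Fermat form *)

Section Macaulay.
Variables (C : numClosedFieldType) (n d : nat).
Hypotheses (n0 : (0 < n)%N) (d0 : (0 < d)%N).

Definition fermat : {mpoly C[n]} := \sum_(i < n) 'X_i ^+ d.

(** Otherwise the degree would be at most [n * d.-1 < n * d]. *)
Lemma large_exponent (m : 'X_{1..n}) : mdeg m = (n * d)%N ->
  exists i : 'I_n, (d.-1 <= m i)%N.
Proof.
move=> hm; apply/existsP; apply: contraT => /existsPn small.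
have : (mdeg m <= \sum_(i < n) d.-1)%N.
  by rewrite mdegE leq_sum // => i _; have := small i; rewrite -ltnNge => /ltnW.
rewrite sum_nat_const card_ord hm leq_pmul2l // => le_d.
by rewrite -ltnS prednK // ltnn in le_d.
Qed.

(** Row [k] of the matrix lists the coefficients of the [k]-th monomial of degree
    [D], in which a factor [x_i^(d-1)] has been replaced by the [i]-th partial
    derivative of [f].  At a singular point [p] every row is orthogonal to the
    vector [w] of the values at [p] of these monomials. *)
Lemma macaulay_form : exists (e : nat) (F : {mpoly C[#|exponent n d|]}),
  [/\ F \is e.-homog, F.@[coords (d := d) fermat] != 0 &
    forall f, f \is d.-homog -> F.@[coords (d := d) f] != 0 -> ~ singular f].
Proof.
pose D := (n * d)%N.
pose mon : 'I_#|exponent n D| -> 'X_{1..n} := @nth_exponent n D.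
have /fin_all_exists [s sP] : forall k, exists i : 'I_n, (d.-1 <= mon k i)%N.
  by move=> k; apply: large_exponent; rewrite mdeg_nth_exponent.
pose q k : {mpoly C[n]} := 'X_[mon k - U_(s k) *+ d.-1].
have le_s k : (U_(s k) *+ d.-1 <= mon k)%MM.
  apply/mnm_lepP => j.
  by rewrite mulmnE mnm1E; case: eqP => [<-|_]; rewrite ?mul1n // mul0n.
have qK k : q k * 'X_(s k) ^+ d.-1 = 'X_[mon k].
  by rewrite mpolyXn -mpolyXD submK.
pose L k l : {scalar {mpoly C[n]}} := partial_coef (q k) (s k) (mon l).
have [F hF detF] := det_as_form d L.
exists #|exponent n D|, F; split => //.
  rewrite detF; last first.
    apply: rpred_sum => i _; have := dhomogMn d (_ : 'X_i \is 1.-homog).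
    by rewrite mul1n; apply; rewrite dhomogX /= mdeg1.
  (* The partial derivatives of the Fermat form are the [d x_i^(d-1)], so each
     row of the matrix is [d] times the monomial that it comes from. *)
  have -> : \matrix_(k, l) L k l fermat = d%:R%:M.
    apply/matrixP => k l; rewrite !mxE /= /partial_coef.
    have -> : fermat^`M(s k) = d%:R *: 'X_(s k) ^+ d.-1.
      rewrite /fermat raddf_sum (bigD1 (s k)) //= big1 ?addr0 => [|i ik].
        have UU : (U_(s k) - U_(s k))%MM = 0%MM.
          by apply/mnmP => j; rewrite mnmBE subnn mnm0E.
        rewrite power_mderiv mderivX mnm1E eqxx UU.
        by rewrite scale1r mpolyX0 mulr1 scaler_nat.
      by rewrite power_mderiv mderivX mnm1E (negbTE ik) scale0r mulr0 mul0rn.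
    rewrite -scalerAr qK mcoeffZ mcoeffX (inj_eq (@nth_exponent_inj n D)).
    by rewrite mulr_natr.
  by rewrite det_scalar expf_neq0 // pnatr_eq0 -lt0n.
move=> f hf; rewrite detF // => det_nz [p [[j pj0] p_sing]].
pose w := \row_l ('X_[mon l] : {mpoly C[n]}).@[p].
have : w *m (\matrix_(k, l) L k l f)^T = 0.
  apply/rowP => k; rewrite !mxE.
  have hk : q k * f^`M(s k) \is D.-homog.
    have -> : D = (mdeg (mon k - U_(s k) *+ d.-1) + d.-1)%N.
      rewrite -[LHS](mdeg_nth_exponent k) -/(mon k) -{1}(submK (le_s k)).
      by rewrite mdegD mdegMn mdeg1 mul1n.
    by apply: dhomogM; [rewrite dhomogX | exact: dhomog_mderiv].
  transitivity (q k * f^`M(s k)).@[p]; last by rewrite mevalM p_sing mulr0.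
  rewrite (homog_expansion hk) rmorph_sum; apply: eq_bigr => l _.
  by rewrite !mxE /= mevalZ mulrC.
(* The vector [w] contains the power [p j ^+ D] of a nonzero coordinate. *)
move=> wM; have : w != 0.
  have [l lE] : exists l, mon l = (U_(j) *+ D)%MM.
    by apply: nth_exponent_onto; rewrite mdegMn mdeg1 mul1n.
  apply/eqP => /rowP/(_ l); rewrite !mxE lE -mpolyXn rmorphXn /= mevalXU.
  by move/eqP; rewrite expf_eq0 (negbTE pj0) andbF.
move=> w0; move: det_nz; rewrite -det_tr => /negP; apply.
by apply/det0P; exists w.
Qed.

End Macaulay.

(** * General points of the secant varieties *)

(** The [r - n] superfluous linear forms are zero. *)
Lemma fermat_power_sum (C : numClosedFieldType) (n d r : nat) :
  (0 < d)%N -> (n <= r)%N ->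
  exists l : 'I_r -> {mpoly C[n]}, (forall i, l i \is 1.-homog) /\
    power_sum d (fun => 1) l = fermat C n d.
Proof.
move=> d0 nr.
pose l k : {mpoly C[n]} := oapp (fun j : 'I_n => 'X_j) 0 (insub k).
exists (fun i => l i); split => [i|].
  rewrite /l; case: insub => [j|] /=; last exact: dhomog0.
  by rewrite dhomogX /= mdeg1.
rewrite /fermat.
transitivity (\sum_(i < n) l i ^+ d); last first.
  by apply: eq_bigr => i _; rewrite /l valK.
rewrite (big_ord_widen r (fun k => l k ^+ d)) // big_mkcond.
apply: eq_bigr => i _; rewrite scale1r; case: ltnP => // ni.
by rewrite /l insubF ?ltnNge ?ni //= expr0n eqn0Ngt d0.
Qed.

Theorem corollary2p4 (R : realType) (n d r : nat) (hd : (0 < d)%N) :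
  ((1 < d)%N -> (r < n)%N ->
     general_of_border_rank d r
       [set f : {mpoly R[i][n]} | singular f]) /\
  ((n <= r)%N ->
     general_of_border_rank d r
       [set f : {mpoly R[i][n]} | ~ singular f]).
Proof.
split=> [d1 rn|nr].
  exists set0; split; first exact: set0_closed.
    by rewrite setD0; apply: sub_gen_smallest.
  rewrite setD0 => f Xf.
  have [[hf f0] [v v0 dep]] : dependent_partials d f.
    apply: smallest_sub Xf; first exact: dependent_partials_closed.
    exact: few_powers_dependent_partials.
  by exists (v 0); exact: singular_of_dependent_partials d1 hf v0 dep.
have [n0|n0] := posnP n.
  exists set0; split; first exact: set0_closed.
    by rewrite setD0; apply: sub_gen_smallest.
  move=> f _ [p [[i _] _]].
  by have := leq_ltn_trans (leq0n i) (ltn_ord i); rewrite n0.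
have [e [F [hF F_fermat F_sing]]] := macaulay_form R[i] n0 hd.
have [l [hl lE]] := fermat_power_sum R[i] hd nr.
apply: (@general_of_nonvanishing _ _ _ _ n0 hd e F (fun => 1) l) => //.
(* The zero form is singular, which forces [F] to vanish there. *)
- apply/eqP; apply: contraT => /(F_sing _ (dhomog0 _ _ _)) []; exists (fun => 1).
  split => [|i]; last by rewrite mderiv0 meval0.
  by exists (Ordinal n0); exact: oner_neq0.
- by rewrite lE.
Qed.
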